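(* For any real $\zeta>1$, \[0\leq\tilde{\epsilon}_1(\zeta)\leq\min\left\{\frac12,\frac{1}{2(\zeta-1)}\right\},\qquad \frac{1}{2(\zeta+1)}\leq\tilde{\epsilon}_2(\zeta)\leq\min\left\{\frac12,\frac{1}{\zeta-1}\right\}.\] Moreover, for any $\zeta\in(1,\infty)\setminus\Gamma$ we have $\tilde{\epsilon}_2(\zeta)\leq\min\{\frac12,\frac{1}{2(\zeta-1)}\}$.
   Context: For real $x$, $\Vert x\Vert$ denotes the distance from $x$ to the nearest integer, $\{x\}$ the fractional part, and $\langle x\rangle$ the integer nearest to $x$ (with $\langle x\rangle:=\lfloor x\rfloor$ if $\{x\}=1/2$). For real $\zeta>1$ and $\epsilon>0$, let $\varpi_{\epsilon,\zeta}$ be the set of all real $\alpha\neq 0$ such that $\Vert\alpha\zeta^n\Vert\leq\epsilon$ for all integers $n\geq n_0$, for some integer $n_0=n_0(\alpha,\zeta,\epsilon)$. Define $\tilde{\epsilon}_1(\zeta):=\sup\{\epsilon>0:\varpi_{\epsilon,\zeta}=\emptyset\}$ and $\tilde{\epsilon}_2(\zeta):=\sup\{\epsilon>0: \varpi_{\epsilon,\zeta}\text{ is at most countable}\}$, with $\sup\emptyset=0$. For real $\zeta$ and a positive integer $N_0$, define $(N_j)_{j\geq0}$ by $N_{j+1}=\langle\zeta N_j\rangle$; let $W(\zeta)$ be the set of positive integers $N_0$ for which $1/2$ does not lie in the closure of $\{\{N_j\zeta\}:j\geq 0\}$, and let $\Gamma$ be the set of real $\zeta>3/2$ with $W(\zeta)\neq\emptyset$.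 *)

(* Defs.v *)
From HB Require Import structures.
From mathcomp Require Import all_boot all_order all_algebra.
From mathcomp Require Import all_classical all_reals all_analysis.
From mathcomp Require Import lra.

Set Implicit Arguments.
Unset Strict Implicit.
Unset Printing Implicit Defensive.

Import Order.TTheory GRing.Theory Num.Theory numFieldNormedType.Exports.

Local Open Scope classical_set_scope.
Local Open Scope ring_scope.

Definition frac {R : realType} (x : R) : R := x - (Num.floor x)%:~R.

(* Ties (frac x = 1/2) are rounded down. *)
Definition nearest {R : realType} (x : R) : int :=
  if frac x <= 1 / 2 then Num.floor x else Num.floor x + 1.

Definition dist_int {R : realType} (x : R) : R := `|x - (nearest x)%:~R|.

Lemma dist_int_min (R : realType) (x : R) (m : int) :
  dist_int x <= `|x - m%:~R|.
Proof.
have h0 := floor_le x; have h1 := floorD1_gt x; rewrite intrD in h1.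
have [le_m|lt_m] := leP m (Num.floor x).
- move: le_m; rewrite -(ler_int R) => le_m.
  rewrite (ger0_norm (x := x - m%:~R)); last by lra.
  rewrite /dist_int /nearest /frac; case: ifPn; rewrite -?ltNge => h.
  + by rewrite ger0_norm; lra.
  + by rewrite intrD ler0_norm; lra.
- move: lt_m; rewrite -lezD1 -(ler_int R) intrD => lt_m.
  rewrite (ler0_norm (x := x - m%:~R)); last by lra.
  rewrite /dist_int /nearest /frac; case: ifPn; rewrite -?ltNge => h.
  + by rewrite ger0_norm; lra.
  + by rewrite intrD ler0_norm; lra.
Qed.

Definition varpi {R : realType} (eps zeta : R) : set R :=
  [set alpha | alpha != 0 /\
    exists n0 : int, forall n : int,
      n0 <= n -> dist_int (alpha * zeta ^ n) <= eps].

(* In both definitions [sup] is the true supremum, with [sup set0 = 0]: the sets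
   are bounded above by 1/2, since [varpi eps zeta] is the set of all nonzero
   reals for eps >= 1/2. *)
Definition eps1 {R : realType} (zeta : R) : R :=
  sup [set eps : R | 0 < eps /\ varpi eps zeta = set0].

Definition eps2 {R : realType} (zeta : R) : R :=
  sup [set eps : R | 0 < eps /\ countable (varpi eps zeta)].

Fixpoint Nseq {R : realType} (zeta : R) (N0 : int) (j : nat) : int :=
  if j is j'.+1 then nearest (zeta * (Nseq zeta N0 j')%:~R) else N0.

Definition W {R : realType} (zeta : R) : set int :=
  [set N0 | 0 < N0 /\
    ~ closure (range (fun j : nat => frac ((Nseq zeta N0 j)%:~R * zeta)))
        (1 / 2)].

Definition Gamma {R : realType} : set R :=
  [set zeta | 3 / 2 < zeta /\ W zeta !=set0].

(* Main.v *)
(* An integer sequence with |N_(j+1) - z N_j| <= c shadows a real orbit: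
   |alpha z^j - N_j| <= c/(z-1) for alpha = lim N_j / z^j. Rounding to the
   nearest integer gives c = 1/2, which bounds eps1; choosing freely between
   floor and ceiling gives c = 1 and a full binary tree of sequences, which
   bounds eps2. Outside Gamma, the product z N_j comes arbitrarily close to a
   half-integer along every nearest-integer orbit, where both roundings cost
   about 1/2, so that a binary tree exists with c slightly above 1/2. For
   c/(z-1) < 1/2 the sequence is recovered from alpha, so the branches give
   distinct alpha. Conversely, for eps < 1/(2(z+1)) the nearest integers to
   alpha z^n eventually follow the deterministic rounding rule, which leaves
   countably many alpha. *)
Require Import Defs.
From mathcomp Require Import all_boot all_order all_algebra.
From mathcomp Require Import all_classical all_reals all_analysis.
From mathcomp Require Import ring lra.

Set Implicit Arguments.
Unset Strict Implicit.
Unset Printing Implicit Defensive.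

Import Order.TTheory GRing.Theory Num.Theory numFieldNormedType.Exports.

Local Open Scope classical_set_scope.
Local Open Scope ring_scope.

(** * Rounding to the nearest integer *)

Lemma floor_bounds (R : realType) (x : R) :
  (Num.floor x)%:~R <= x < (Num.floor x)%:~R + 1.
Proof. by rewrite floor_le -[X in _ + X]/(1%:~R) -intrD floorD1_gt. Qed.

Lemma dist_int_le_half (R : realType) (x : R) : dist_int x <= 1 / 2.
Proof.
have /andP[h0 h1] := floor_bounds x.
rewrite /dist_int /nearest /Defs.frac; case: ifPn; rewrite -?ltNge => h.
- by rewrite ger0_norm; lra.
- by rewrite intrD mulr1z ler0_norm; lra.
Qed.

(** Both [m] and [nearest x] lie at distance less than 1/2 from [x], and integers less than 1 apart
    coincide. *)
Lemma nearest_eq (R : realType) (x : R) (m : int) :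
  `|x - m%:~R| < 1 / 2 -> nearest x = m.
Proof.
move=> xm; have xn := le_lt_trans (dist_int_min x m) xm.
apply/eqP; rewrite -subr_eq0 -absz_eq0 -leqn0 -ltnS -ltz_nat abszE.
rewrite -(ltr_int R) intr_norm intrB.
have -> : (nearest x)%:~R - m%:~R = (x - m%:~R) - (x - (nearest x)%:~R) :> R.
  by ring.
rewrite (le_lt_trans (ler_normB _ _))//.
by move: xm xn; rewrite /dist_int; lra.
Qed.

Lemma floor_le_nearest (R : realType) (x : R) : Num.floor x <= nearest x.
Proof. by rewrite /nearest; case: ifP; rewrite ?lerDl. Qed.

(** * Growth of powers and shadowing *)

Lemma expr_unbounded (R : realType) (z M : R) :
  1 < z -> exists n : nat, M < z ^+ n.
Proof.
move=> z1.
have bern (n : nat) : 1 + n%:R * (z - 1) <= z ^+ n.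
  elim: n => [|n IHn]; first by rewrite expr0; lra.
  have n0 : 0 <= n%:R * (z - 1) by rewrite mulr_ge0//; lra.
  have d0 : 0 <= (z - 1) * (n%:R * (z - 1)) by rewrite mulr_ge0//; lra.
  have : z * (1 + n%:R * (z - 1)) <= z * z ^+ n by rewrite ler_pM2l//; lra.
  rewrite exprS -natr1; move: d0; set w := n%:R * (z - 1).
  rewrite [(_ + 1) * (z - 1)]mulrDl -/w; lra.
exists (Num.bound `|M / (z - 1)|); apply: lt_le_trans (bern _).
have /(le_lt_trans (ler_norm _)) := archi_boundP (normr_ge0 (M / (z - 1))).
rewrite ltr_pdivrMr; last by lra.
by move=> /lt_le_trans; apply; lra.
Qed.

(** Serves to identify two reals, with [g] their difference: a nonzero [g] would make [g * z ^+ n]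
    unbounded. *)
Lemma bounded_expr_eq0 (R : realType) (z g M : R) (n0 : nat) : 1 < z ->
  (forall n, (n0 <= n)%N -> `|g * z ^+ n| <= M) -> g = 0.
Proof.
move=> z1 gM; apply/eqP; rewrite -normr_le0 leNgt; apply/negP => g0.
have [n Mn] := @expr_unbounded R z (M / `|g|) z1.
have := gM (maxn n0 n) (leq_maxl _ _); apply/negP; rewrite -ltNge normrM.
rewrite mulrC -ltr_pdivrMr// (lt_le_trans Mn)//.
rewrite ger0_norm ?exprn_ge0//; last by lra.
by rewrite ler_eXn2l// leq_maxr.
Qed.

(* With e := c / (z - 1), so that z * e = e + c, the intervals
   [N j - e, N j + e] / z ^ j are nested. *)
Lemma shadowing (R : realType) (z c : R) (N : nat -> int) : 1 < z ->
  (forall j, `|(N j.+1)%:~R - z * (N j)%:~R| <= c) ->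
  exists alpha : R, forall j, `|alpha * z ^+ j - (N j)%:~R| <= c / (z - 1).
Proof.
move=> z1 Nc; set e := c / (z - 1).
have ze : z * e = e + c by rewrite /e; field; lra.
have c0 : 0 <= c by apply: le_trans (Nc 0%N).
have e0 : 0 <= e by rewrite divr_ge0//; lra.
have zp j : 0 < z ^+ j by rewrite exprn_gt0//; lra.
pose L j := ((N j)%:~R - e) / z ^+ j; pose U j := ((N j)%:~R + e) / z ^+ j.
have L_homo : {homo L : i j / (i <= j)%N >-> i <= j}.
  apply: homo_leq => [//|x y w|j]; first exact: le_trans.
  rewrite /L exprS invfM mulrA ler_pM2r ?invr_gt0// ler_pdivlMr; last by lra.
  by have := Nc j; rewrite ler_norml => /andP[]; lra.
have U_homo : {homo U : i j / (i <= j)%N >-> j <= i}.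
  apply: homo_leq => [//|x y w xy yw|j]; first exact: le_trans yw xy.
  rewrite /U exprS invfM mulrA ler_pM2r ?invr_gt0// ler_pdivrMr; last by lra.
  by have := Nc j; rewrite ler_norml => /andP[]; lra.
have LU i j : L i <= U j.
  apply: (le_trans (L_homo _ _ (leq_maxl i j))).
  apply: le_trans (U_homo _ _ (leq_maxr i j)).
  by rewrite ler_pM2r ?invr_gt0//; lra.
have supL : has_sup (range L).
  by split; [exists (L 0%N), 0%N|exists (U 0%N) => _ [i _ <-]].
exists (sup (range L)) => j.
have lb : L j <= sup (range L) by apply: ub_le_sup; [exact: supL.2|exists j].
have ub : sup (range L) <= U j.
  by apply: ge_sup => [|_ [i _ <-]//]; exact: supL.1.
move: lb ub; rewrite /L /U ler_pdivrMr// ler_pdivlMr// => lb ub.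
by rewrite ler_norml; lra.
Qed.

(** * Nonemptiness and countability of [varpi] *)

Lemma varpi_of_approx (R : realType) (eps z alpha : R) (N : nat -> int) :
  alpha != 0 -> (forall j, `|alpha * z ^+ j - (N j)%:~R| <= eps) ->
  varpi eps z alpha.
Proof.
move=> a0 aN; split=> //; exists 0 => -[j|//] _.
by rewrite -exprnP (le_trans (dist_int_min _ _) (aN j)).
Qed.

(** [varpi] excludes 0, so shadowed sequences start at 1: with [alpha = 0] the term [j = 0] would
    give [1 <= eps]. *)
Lemma approx_neq0 (R : realType) (eps z alpha : R) (N : nat -> int) :
  eps < 1 -> N 0%N = 1 -> (forall j, `|alpha * z ^+ j - (N j)%:~R| <= eps) ->
  alpha != 0.
Proof.
move=> eps1 N0 /(_ 0%N); rewrite N0 expr0 mulr1; apply: contraTneq => ->.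
by rewrite sub0r normrN normr1 -ltNge.
Qed.

Lemma varpi_half (R : realType) (eps z : R) :
  1 / 2 <= eps -> varpi eps z = [set alpha | alpha != 0].
Proof.
move=> heps; apply/seteqP; split=> [a []//|a a0]; split=> //.
by exists 0 => n _; rewrite (le_trans (dist_int_le_half _)).
Qed.

Lemma varpi_nonempty (R : realType) (eps z : R) :
  1 < z -> 1 / (2 * (z - 1)) <= eps -> varpi eps z !=set0.
Proof.
move=> z1 heps; have [eps_half|eps_half] := leP (1 / 2) eps.
  by exists 1; rewrite varpi_half//=.
have err j : `|(Nseq z 1 j.+1)%:~R - z * (Nseq z 1 j)%:~R| <= 1 / 2.
  by rewrite distrC; exact: dist_int_le_half.
have [alpha aN] := @shadowing R z (1 / 2) _ z1 err.
have aN' j : `|alpha * z ^+ j - (Nseq z 1 j)%:~R| <= eps.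
  rewrite (le_trans (aN j))// (le_trans _ heps)//.
  by rewrite !mul1r invfM.
exists alpha; apply: (varpi_of_approx _ aN').
by apply: (approx_neq0 _ _ aN') => //; lra.
Qed.

(* For eps < 1/(2(z+1)), |N_(n+1) - z N_n| <= (z+1) eps < 1/2, so a tail of
   nearest integers, hence alpha, is determined by one of its terms. *)
Lemma varpi_countable (R : realType) (eps z : R) :
  1 < z -> eps < 1 / (2 * (z + 1)) -> countable (varpi eps z).
Proof.
move=> z1 heps; have {}heps : eps * (z + 1) < 1 / 2.
  by move: heps; rewrite invfM mul1r ltr_pdivlMr//; lra.
have nat_start alpha : varpi eps z alpha -> exists n0 : nat,
    forall n : nat, (n0 <= n)%N -> dist_int (alpha * z ^+ n) <= eps.
  move=> [_ [n0 aeps]]; exists `|n0|%N => n n0n; rewrite exprnP; apply: aeps.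
  by rewrite (le_trans (lez_abs _))// lez_nat.
pose start alpha := xget 0%N [set n0 : nat |
  forall n : nat, (n0 <= n)%N -> dist_int (alpha * z ^+ n) <= eps].
have startP alpha : varpi eps z alpha ->
    forall n : nat, (start alpha <= n)%N -> dist_int (alpha * z ^+ n) <= eps.
  by move=> /nat_start[n0 hn0]; rewrite /start; case: xgetP => [m _ //|/(_ n0)].
pose code alpha := (start alpha, nearest (alpha * z ^+ start alpha)).
have orbit alpha : varpi eps z alpha -> forall j : nat,
    nearest (alpha * z ^+ (start alpha + j)) = Nseq z (code alpha).2 j.
  move=> /startP aeps; elim=> [|j IHj]; first by rewrite addn0.
  rewrite /= -IHj; apply/esym/nearest_eq.
  set n := (start alpha + j)%N; rewrite addnS -/n.
  have h0 := aeps n (leq_addr _ _).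
  have h1 := aeps n.+1 (leqW (leq_addr _ _)).
  apply: le_lt_trans heps; move: h0 h1; rewrite /dist_int exprS.
  set x := (nearest _)%:~R; set y := (nearest _)%:~R; rewrite !ler_norml.
  by move=> /andP[? ?] /andP[? ?]; apply/andP; split; nra.
have code_inj : {in varpi eps z &, injective code}.
  move=> a b; rewrite !inE => va vb ab; apply/eqP; rewrite -subr_eq0; apply/eqP.
  have sab : start a = start b by case: ab.
  (* Both multiples are within [eps] of the same integer, whence the bound [eps + eps]. *)
  apply: (@bounded_expr_eq0 R z _ (eps + eps) (start a) z1) => n hn.
  have := startP a va n hn; have := startP b vb n; rewrite -sab => /(_ hn).
  have oab : nearest (a * z ^+ n) = nearest (b * z ^+ n).
    rewrite -(subnKC hn) (orbit _ va) ab -(orbit _ vb).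
    by rewrite -sab.
  rewrite /dist_int oab !ler_norml => /andP[? ?] /andP[? ?].
  by apply/andP; split; lra.
apply/countable_injP; exists (pickle \o code) => a b ia ib /=.
by move=> /(pcan_inj (@pickleK _))/code_inj; exact.
Qed.

(** * Uncountability of [varpi] from binary trees *)

Lemma not_countable_of_binary (T : choiceType) (A : set T)
    (f : (nat -> bool) -> T) :
  (forall b, A (f b)) -> injective f -> ~ countable A.
Proof.
move=> Af f_inj /countable_injP[g g_inj].
(* Cantor's diagonal argument: [dec] would enumerate all bit sequences, and [d] flips its
   diagonal. *)
pose dec n := xget (fun=> false) [set b | g (f b) = n].
have gfK b : dec (g (f b)) = b.
  rewrite /dec; case: xgetP => [b' _ /= /g_inj bb'|/(_ b)[]//].
  by apply: f_inj; apply: bb'; rewrite inE.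
pose d n := ~~ dec n n.
have : dec (g (f d)) (g (f d)) = d (g (f d)) by rewrite gfK.
by rewrite [RHS]/d; case: (dec _ _).
Qed.

Section Branching.
Variables (R : realType) (z delta : R).

(** The branching points: rounding [z * N] to its floor or to the floor plus one costs at most
    [1 / 2 + delta] either way. *)
Definition near_half (N : int) : bool :=
  `|Defs.frac (z * N%:~R) - 1 / 2| <= delta.

(* The second component counts the branchings so far, so that each bit of [b]
   is consumed by exactly one branching. *)
Fixpoint branch (b : nat -> bool) (j : nat) : int * nat :=
  if j is j'.+1 then
    let: (N, k) := branch b j' in
    if near_half N then (Num.floor (z * N%:~R) + (b k)%:Z, k.+1)
    else (nearest (z * N%:~R), k)
  else (1, 0%N).

Lemma branch_gt0 b j : 1 < z -> 0 < (branch b j).1.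
Proof.
move=> z1; elim: j => //= j; case: (branch b j) => N k /= N0.
have fN : N <= Num.floor (z * N%:~R).
  rewrite floor_ge_int ler_peMl ?ler0z ?ltW//.
have f0 := lt_le_trans N0 fN.
by case: ifP => _ /=; [rewrite ltr_wpDr|exact: lt_le_trans f0 (floor_le_nearest _)].
Qed.

Lemma branch_err b j : 0 <= delta ->
  `|(branch b j.+1).1%:~R - z * (branch b j).1%:~R| <= 1 / 2 + delta.
Proof.
move=> d0 /=; case: (branch b j) => N k /=; case: ifP => /= [|_]; last first.
  by rewrite distrC (le_trans (dist_int_le_half _))//; lra.
rewrite /near_half /Defs.frac !ler_norml intrD => /andP[? ?].
by apply/andP; case: (b k) => /=; split; lra.
Qed.

Hypothesis z_gt1 : 1 < z.
Hypothesis near_halfP : forall N, 0 < N -> exists j, near_half (Nseq z N j).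

(** Until its first branching point the branch follows the nearest-integer orbit, with the counter
    frozen; [near_halfP] applies because terms are positive. *)
Lemma branch_next b j0 : exists j,
  near_half (branch b j).1 /\ (branch b j).2 = (branch b j0).2.
Proof.
have ex := near_halfP (branch_gt0 b j0 z_gt1).
have [m hm m_min] := ex_minnP ex.
have run i : (i <= m)%N ->
    branch b (j0 + i) = (Nseq z (branch b j0).1 i, (branch b j0).2).
  elim: i => [|i IHi] im; first by rewrite addn0; case: branch.
  rewrite addnS /= IHi ?(ltnW im)//.
  case: ifPn => // /m_min; by rewrite leqNgt im.
by exists (j0 + m)%N; rewrite run.
Qed.

Lemma branch_counter b k : exists j,
  near_half (branch b j).1 /\ (branch b j).2 = k.
Proof.
elim: k => [|k [j [hj jk]]]; first exact: (branch_next b 0).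
have [j' [hj' j'k]] := branch_next b j.+1; exists j'; split=> //.
rewrite j'k /=; move: hj jk; case: (branch b j) => N k' /= -> /= ->.
by [].
Qed.

(** The integers alone determine the counters, since branching depends only on the current integer.
    At the branching with counter [k] the next integers then reveal [b k] and [b' k]. *)
Lemma branch_inj b b' :
  (forall j, (branch b j).1 = (branch b' j).1) -> b = b'.
Proof.
move=> bb'; have counter j : (branch b j).2 = (branch b' j).2.
  elim: j => //= j; have := bb' j.
  by case: (branch b j) (branch b' j) => N k [N' k'] /= -> ->; case: ifP.
apply/funext => k; have [j [hj jk]] := branch_counter b k.
have := bb' j.+1; have := bb' j; have := counter j; move: hj jk => /=.
case: (branch b j) (branch b' j) => N i [N' i'] /= hN -> <- <-.
by rewrite hN /= => /addrI; case: (b k) (b' k) => -[].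
Qed.

Lemma varpi_uncountable_of_branching eps :
  0 <= delta -> (1 / 2 + delta) / (z - 1) <= eps -> eps < 1 / 2 ->
  ~ countable (varpi eps z).
Proof.
move=> d0 deps eps_half.
have ex b : exists alpha : R,
    forall j, `|alpha * z ^+ j - (branch b j).1%:~R| <= eps.
  have [||a ha] := @shadowing R z (1 / 2 + delta) (fun j => (branch b j).1).
  - exact: z_gt1.
  - by move=> j; exact: branch_err.
  by exists a => j; exact: le_trans (ha j) deps.
have [f fP] := choice ex.
apply: (@not_countable_of_binary _ _ f) => [b|b b' fbb'].
  apply: (varpi_of_approx _ (fP b)).
  by apply: (approx_neq0 _ _ (fP b)) => //; lra.
(* As [eps < 1 / 2], rounding [f b * z ^+ j] recovers the branch. *)
apply: branch_inj => j.
rewrite -(nearest_eq (le_lt_trans (fP b j) eps_half)) fbb'.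
exact/nearest_eq/(le_lt_trans (fP b' j)).
Qed.

End Branching.

Lemma varpi_uncountable_half (R : realType) (eps z : R) :
  1 / 2 <= eps -> ~ countable (varpi eps z).
Proof.
move=> heps; rewrite varpi_half// => nz_count.
(* This interval avoids 0 and has Lebesgue measure 1, whereas countable sets are null. *)
have : countable (`[1, 2]%classic : set R).
  apply: sub_countable nz_count; apply: subset_card_le => x /=.
  by rewrite in_itv/= => /andP[x1 _]; lra.
move=> /countable_lebesgue_measure0; rewrite lebesgue_measure_itv/= lte_fin.
rewrite ifT; last by lra.
by rewrite -EFinB => -[]; lra.
Qed.

Lemma varpi_uncountable (R : realType) (eps z : R) :
  1 < z -> 1 / (z - 1) <= eps -> ~ countable (varpi eps z).
Proof.
move=> z1 heps; have [|eps_half] := leP (1 / 2) eps.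
  exact: varpi_uncountable_half.
(* With [delta = 1 / 2] every integer is a branching point. *)
apply: (@varpi_uncountable_of_branching R z (1 / 2)) eps_half => //; last 1 first.
- by have -> : 1 / 2 + 1 / 2 = 1 :> R by lra.
- move=> N _; exists 0%N => /=; rewrite /near_half /Defs.frac.
  have /andP[h0 h1] := floor_bounds (z * N%:~R).
  by rewrite ler_norml; lra.
Qed.

Lemma varpi_uncountable_notGamma (R : realType) (eps z : R) :
  1 < z -> ~ Gamma z -> 1 / (2 * (z - 1)) < eps -> ~ countable (varpi eps z).
Proof.
move=> z1 nG heps; have [|eps_half] := leP (1 / 2) eps.
  exact: varpi_uncountable_half.
have heps' : 1 / 2 < eps * (z - 1).
  by move: heps; rewrite invfM mul1r ltr_pdivrMr//; lra.
(* Chosen so that [(1 / 2 + delta) / (z - 1) = eps]. *)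
pose delta := eps * (z - 1) - 1 / 2.
have delta0 : 0 < delta by rewrite /delta; lra.
(* In fact [eps < 1 / 2] forces [z > 2]; this rules out that [z] misses [Gamma] merely by being at
   most 3/2. *)
have z32 : 3 / 2 < z by nra.
apply: (@varpi_uncountable_of_branching R z delta) eps_half => //.
- move=> N N0; have cl : closure
      (range (fun j => Defs.frac ((Nseq z N j)%:~R * z))) (1 / 2).
    by apply: contrapT => ncl; apply: nG; split=> //; exists N.
  have [_ [[j _ <-] hj]] := cl _ (nbhsx_ballx (1 / 2 : R) delta delta0).
  by exists j; rewrite /near_half distrC [z * _]mulrC; exact: ltW.
- exact: ltW.
- by rewrite ler_pdivrMr /delta; lra.
Qed.

(** * Passage to the suprema *)

Lemma sup_le_min (R : realType) (A : set R) (x y : R) : 0 <= x -> 0 <= y ->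
  (forall e, A e -> e <= x /\ e <= y) -> sup A <= Num.min x y.
Proof.
move=> x0 y0 Axy; have [->|/set0P A0] := eqVneq A set0.
  by rewrite sup0 le_min x0.
by apply: ge_sup => // e /Axy[ex ey]; rewrite le_min ex.
Qed.

Unset Implicit Arguments.

Theorem theorem4p4 (R : realType) :
  (forall zeta : R, 1 < zeta ->
     (0 <= eps1 zeta /\
      eps1 zeta <= Num.min (1 / 2) (1 / (2 * (zeta - 1)))) /\
     (1 / (2 * (zeta + 1)) <= eps2 zeta /\
      eps2 zeta <= Num.min (1 / 2) (1 / (zeta - 1)))) /\
  (forall zeta : R, (`]1, +oo[ `\` Gamma) zeta ->
     eps2 zeta <= Num.min (1 / 2) (1 / (2 * (zeta - 1)))).
Proof.
have le_half z e : countable (varpi e z) -> e <= 1 / 2 :> R.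
  by move=> ce; rewrite leNgt; apply/negP => /ltW/varpi_uncountable_half/(_ ce).
split=> [z z1|z []]; last first.
  rewrite /= in_itv/= andbT => z1 nG.
  apply: sup_le_min => [||e [e0 ce]]; [lra|rewrite divr_ge0//; lra|split].
    exact: le_half ce.
  by rewrite leNgt; apply/negP => /(varpi_uncountable_notGamma z1 nG)/(_ ce).
split; split.
- rewrite /eps1; set A := [set _ | _]; have [->|/set0P[e Ae]] := eqVneq A set0.
    by rewrite sup0.
  apply: le_trans (ltW Ae.1) _; apply: ub_le_sup Ae.
  (* The empty set is countable, so [le_half] bounds this set too. *)
  by exists (1 / 2) => x [_ x0]; apply: (le_half z); rewrite x0.
- apply: sup_le_min => [||e [e0 ce]]; [lra|rewrite divr_ge0//; lra|split].
    by apply: (le_half z); rewrite ce.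
  rewrite leNgt; apply/negP => /ltW/(varpi_nonempty z1).
  by rewrite ce => -[].
- have ub : has_ubound [set e : R | 0 < e /\ countable (varpi e z)].
    by exists (1 / 2) => e [_ /le_half].
  rewrite leNgt; apply/negP => lt_eps2.
  have p0 : 0 < 1 / (2 * (z + 1)) by rewrite divr_gt0//; lra.
  have mem e : 0 < e -> e < 1 / (2 * (z + 1)) -> e <= eps2 z.
    by move=> e0 ez; apply: ub_le_sup => //; split=> //; exact: varpi_countable.
  set p := 1 / (2 * (z + 1)) in p0 mem lt_eps2.
  (* Countability is known strictly below [p]. The value [p / 2] makes [eps2 z] positive; then the
     midpoint of [eps2 z] and [p] is admissible yet exceeds [eps2 z]. *)
  have eps2_gt0 : 0 < eps2 z.
    by apply: lt_le_trans (mem (p / 2) _ _); lra.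
  by have := mem ((eps2 z + p) / 2); lra.
- apply: sup_le_min => [||e [e0 ce]]; [lra|rewrite divr_ge0//; lra|split].
    exact: le_half ce.
  by rewrite leNgt; apply/negP => /ltW/(varpi_uncountable z1)/(_ ce).
Qed.
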